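(* There is a family of $\mathfrak{c}$ many pairwise non-isomorphic hypergraph ideals on $\omega$ each of which has the Nikodym property but does not have the Local-to-Global Boundedness Property for submeasures.
   Context: Ideals on $\omega$ are proper and contain all finite sets. A submeasure on $\omega$ is $\varphi\colon\wp(\omega)\to[0,\infty]$ with $\varphi(\emptyset)=0$, $\varphi(\{n\})<\infty$, monotone and subadditive; it is lower semicontinuous (lsc) if $\varphi(A)=\lim_n\varphi(A\cap[0,n])$ for all $A$. Put $\mathrm{fin}(\varphi)=\{A\colon\varphi(A)<\infty\}$ and $\mathrm{exh}(\varphi)=\{A\colon\lim_n\varphi(A\setminus[0,n])=0\}$. A hypergraph is a pair $H=(V(H),E(H))$ with $V(H)$ finite and $E(H)\subseteq\wp(V(H))$. A submeasure $\varphi$ is hypergraph if there are hypergraphs $H_n$, pairwise disjoint finite nonempty $G_n\subseteq\omega$ and bijections $b_n\colon G_n\to V(H_n)$ such that $\varphi(A)=\sup_n\sup_{e\in E(H_n)}|b_n[A\cap G_n]\cap e|/|e|$; an ideal is hypergraph if it equals $\mathrm{exh}(\varphi)$ for a hypergraph submeasure $\varphi$. An ideal $\mathcal{I}$ on $\omega$ has the Nikodym property if every sequence $(\mu_n)$ of finitely additive functions $\mu_n\colon\mathcal{I}\to\mathbb{R}$ with finite norm $\|\mu\|=\sup\{|\mu(A)|+|\mu(B)|\colon A,B\in\mathcal{I},A\cap B=\emptyset\}$ and with $\lim_n\mu_n(A)=0$ for all $A\in\mathcal{I}$ is norm bounded. $\mathcal{I}$ has the Local-to-Global Boundedness Property for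 submeasures if whenever $\varphi$ is an lsc submeasure with $\mathcal{I}\subseteq\mathrm{fin}(\varphi)$, then $\varphi(\omega)<\infty$. Ideals $\mathcal{I},\mathcal{J}$ are isomorphic if there is a bijection $f\colon\omega\to\omega$ with $A\in\mathcal{I}\iff f[A]\in\mathcal{J}$. *)

(* Defs.v *)
From HB Require Import structures.
From mathcomp Require Import all_boot all_order all_algebra.
From mathcomp Require Import all_classical all_reals all_analysis.

Set Implicit Arguments.
Unset Strict Implicit.
Unset Printing Implicit Defensive.

Import Order.TTheory GRing.Theory Num.Theory.
Import numFieldNormedType.Exports.

Local Open Scope classical_set_scope.
Local Open Scope ring_scope.

Definition is_ideal (I : set (set nat)) : Prop :=
  [/\ forall A, finite_set A -> I A,
      forall A B, A `<=` B -> I B -> I A,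
      forall A B, I A -> I B -> I (A `|` B)
    & ~ I [set: nat]].

Definition isomorphic_ideals (I J : set (set nat)) : Prop :=
  exists2 f : nat -> nat, bijective f & forall A, I A <-> J (f @` A).

(* The mathcomp initial segment `I_n.+1 is the interval [0, n] of omega. *)
Section Submeasures.
Variable R : realType.
Implicit Types (phi : set nat -> \bar R) (A B : set nat).
Local Open Scope ereal_scope.

Definition is_submeasure phi : Prop :=
  [/\ (forall A, 0 <= phi A) /\ phi set0 = 0,
      forall n, phi [set n] < +oo,
      forall A B, A `<=` B -> phi A <= phi B
    & forall A B, phi (A `|` B) <= phi A + phi B].

Definition is_lsc phi : Prop :=
  forall A, phi (A `&` `I_n.+1) @[n --> \oo] --> phi A.

Definition fin phi : set (set nat) := [set A | phi A < +oo].

Definition exh phi : set (set nat) :=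
  [set A | phi (A `\` `I_n.+1) @[n --> \oo] --> (0 : \bar R)].

End Submeasures.

Record hypergraph := Hypergraph {
  vertices : finType;
  edges : {set {set vertices}}
}.

(* Suprema are taken in [0, +oo]: a hypergraph without edges contributes 0.
   An empty edge contributes 0 / 0 = 0, so it may be discarded. *)
Definition hypergraph_phi (R : realType) (H : nat -> hypergraph)
    (G : nat -> set nat) (b : forall n, nat -> vertices (H n))
    (A : set nat) : \bar R :=
  ereal_sup (range (fun n : nat =>
    \big[maxe/0%E]_(e in edges (H n))
      (#|[pred v in e | v \in b n @` (A `&` G n)]|%:R / #|e|%:R)%:E)).

Definition is_hypergraph_submeasure (R : realType)
    (phi : set nat -> \bar R) : Prop :=
  is_submeasure phi /\
  exists (H : nat -> hypergraph) (G : nat -> set nat)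
         (b : forall n, nat -> vertices (H n)),
    [/\ forall n, finite_set (G n) /\ G n !=set0,
        trivIset [set: nat] G,
        forall n, set_bij (G n) [set: vertices (H n)] (b n)
      & forall A, phi A = hypergraph_phi R G b A].

Definition is_hypergraph_ideal (R : realType) (I : set (set nat)) : Prop :=
  is_ideal I /\
  exists2 phi : set nat -> \bar R, is_hypergraph_submeasure phi & I = exh phi.

(* A function on the ideal I is given by any extension of it to all subsets of
   omega; only its values on I are ever used. *)
Definition finitely_additive_on (R : realType) (I : set (set nat))
    (mu : set nat -> R) : Prop :=
  forall A B, I A -> I B -> A `&` B = set0 -> mu (A `|` B) = mu A + mu B.

Definition norm_on (R : realType) (I : set (set nat)) (mu : set nat -> R) :
    \bar R :=
  ereal_sup [set x | exists A B,
    [/\ I A, I B, A `&` B = set0 & x = (`|mu A| + `|mu B|)%:E]].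

Definition has_Nikodym (R : realType) (I : set (set nat)) : Prop :=
  forall mu : nat -> set nat -> R,
    (forall n, finitely_additive_on I (mu n)) ->
    (forall n, (norm_on I (mu n) < +oo)%E) ->
    (forall A, I A -> mu n A @[n --> \oo] --> (0 : R)) ->
    exists M : R, forall n, (norm_on I (mu n) <= M%:E)%E.

Definition has_LGBP (R : realType) (I : set (set nat)) : Prop :=
  forall phi : set nat -> \bar R,
    is_submeasure phi -> is_lsc phi -> I `<=` fin phi ->
    (phi [set: nat] < +oo)%E.

(* Main.v *)
Require Import Defs.
From HB Require Import structures.
From mathcomp Require Import all_boot all_order all_algebra.
From mathcomp Require Import all_classical all_reals all_analysis.
From mathcomp Require Import zify lra.

Import Order.TTheory GRing.Theory Num.Theory.
Import numFieldNormedType.Exports.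

Set Implicit Arguments.
Unset Strict Implicit.
Unset Printing Implicit Defensive.

Local Open Scope classical_set_scope.
Local Open Scope ring_scope.

(** The blocks are shift hypergraphs: the vertices are the [d]-tuples over a large [N], and the
    edges consist of [d] consecutive windows of an increasing sequence. A Ramsey argument shows
    that for [N] large a block is not covered by few sets containing at most half of each edge, so
    that the supremum over the blocks of the covering numbers by such sets is an unbounded lower
    semicontinuous submeasure, which is finite on the ideal. On the other hand, choosing random
    sets [C_1, ..., C_q] of indices, the tuples [x] with [x_0] in and [x_i] out of [C_i] for
    [0 < i < q] make up at most about [1 / q] of each edge, and every tuple is chosen with a
    probability depending on [q] only. Hence any measure of large norm has a large value at sets of
    small density; together with Nikodym's theorem on the power sets of members of the ideal this
    gives the Nikodym property. Finally, continuum many non-isomorphic ideals arise by choosing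
    various subsequences of a sequence of blocks in which the edges of a block are much larger than
    all previous blocks together. *)

(** * Monochromatic paths and shift hypergraphs *)

Definition window (d : nat) (h : seq nat) (t : nat) : seq nat := take d (drop t h).

Definition mono_path (T : Type) (c : seq nat -> T) (N d l : nat) (i : T)
    (h : seq nat) : Prop :=
  [/\ size h = (d + l)%N, sorted ltn h, {in h, forall x, (x < N)%N}
    & forall t, (t <= l)%N -> c (window d h t) = i].

Lemma mono_path1 (l : nat) (T : finType) :
  exists N, forall c : seq nat -> T, exists i h, mono_path c N 1 l i h.
Proof.
exists (#|T| * l).+1 => c; set N := (_ * _).+1.
pose s i := [seq x <- iota 0 N | c [:: x] == i].
have sumE : (\sum_i size (s i) = N)%N.
  under eq_bigr do rewrite size_filter -sum1_count big_mkcond /=.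
  rewrite exchange_big /= -[RHS](size_iota 0) -sum1_size.
  apply: eq_bigr => x _; rewrite -big_mkcond /= (bigD1 (c [:: x])) //= big1 //.
  by move=> i /andP[/eqP -> /eqP].
have [i il] : exists i, (l < size (s i))%N.
  apply/existsP; apply: contraT => /existsPn h.
  suff : (N <= #|T| * l)%N by rewrite ltnn.
  rewrite -sumE -sum_nat_const; apply: leq_sum => i _.
  by have := h i; rewrite -leqNgt.
have sub x : x \in take l.+1 (s i) -> (x < N)%N /\ c [:: x] = i.
  by move=> /mem_take; rewrite mem_filter mem_iota => /andP[/eqP -> /=].
exists i, (take l.+1 (s i)); split.
- by rewrite size_take_min; apply/minn_idPl.
- by apply: take_sorted; apply: (sorted_filter ltn_trans); apply: iota_ltn_sorted.
- by move=> x /sub[].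
- move=> t tl; rewrite /window.
  have ts : (t < size (take l.+1 (s i)))%N.
    by rewrite size_take_min; apply: (@leq_trans l.+1); rewrite // (minn_idPl il).
  by rewrite (drop_nth 0%N ts) /= take0; apply: (sub _ _).2; rewrite mem_nth.
Qed.

(* The new colour of a [d]-tuple records the lengths of the monochromatic paths
   of [d.+1]-tuples, seen as arcs between [d]-tuples, that end in it; if an arc
   joins two tuples of the same new colour then such paths can be prolonged. *)
Lemma mono_pathS (d l : nat) (T : finType) : (0 < d)%N ->
  (forall T' : finType,
    exists N, forall c : seq nat -> T', exists i h, mono_path c N d 1 i h) ->
  exists N, forall c : seq nat -> T, exists i h, mono_path c N d.+1 l i h.
Proof.
move=> d0 IH.
have [N HN] := IH {set (T * 'I_l.+1)}.
exists N => c.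
pose chain (i : T) (v : seq nat) (j : nat) := exists h : seq nat,
  [/\ size h = (d + j)%N, sorted ltn h /\ {in h, forall x, (x < N)%N}, drop j h = v
    & forall t, (t < j)%N -> c (window d.+1 h t) = i].
pose f v := [set p : T * 'I_l.+1 | `[< chain p.1 v p.2 >]]%SET.
have [F [h [hs hsort hN fh]]] := HN f.
case/lastP: h => [|v x] in hs hsort hN fh *; first by move: hs; rewrite addn1.
move: hs; rewrite size_rcons addn1 => -[vs].
have fv : f v = F.
  by have := fh 0%N isT; rewrite /window drop0 -cats1 take_cat vs ltnn subnn take0 cats0.
pose w := behead (rcons v x).
have fw : f w = F.
  have := fh 1%N isT; rewrite /window drop1 take_oversize //.
  by rewrite size_behead size_rcons vs.
pose i := c (rcons v x).
have ext j : chain i v j -> chain i w j.+1.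
  move=> [h [hs [hso hN'] hv hc]]; exists (rcons h x).
  have hE : h = take j h ++ v by rewrite -hv cat_take_drop.
  have sj : size (take j h) = j by rewrite size_take_min hs; apply/minn_idPl; lia.
  have drE : drop j (rcons h x) = rcons v x by rewrite drop_rcons ?hv // hs leq_addl.
  split.
  - by rewrite size_rcons hs addnS.
  - split.
      move: hso hsort; rewrite hE.
      case: (v) vs => [vs0|y v' _]; first by move: d0; rewrite -vs0.
      case: (take j h) => [//|z s] /=.
      by rewrite rcons_cat /= !cat_path /= => /and3P[-> ->].
    move=> y; rewrite mem_rcons inE => /orP[/eqP ->|]; last exact: hN'.
    by apply: hN; rewrite mem_rcons mem_head.
  - by rewrite -add1n -drop_drop drE drop1.
  - move=> t; rewrite ltnS leq_eqVlt => /orP[/eqP ->|tj].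
      by rewrite /window drE take_oversize // size_rcons vs.
    rewrite -(hc _ tj) /window drop_rcons ?hs; last by lia.
    rewrite -cats1 takel_cat // size_drop hs; lia.
have cj j : (j <= l)%N -> chain i v j.
  elim: j => [_|j IHj jl].
    exists v; rewrite addn0 drop0; split=> //; split.
      by move: hsort; rewrite -cats1 => /cat_sorted2[].
    by move=> y yv; apply: hN; rewrite mem_rcons inE yv orbT.
  have : (i, @Ordinal l.+1 j.+1 jl) \in f w by rewrite inE; apply/asboolP/ext/IHj/ltnW.
  by rewrite fw -fv inE => /asboolP.
have [h [hs [hso hN'] _ hc]] := ext _ (cj _ (leqnn l)).
by exists i, h; split=> //; rewrite hs addnS.
Qed.

Lemma mono_path_exists (d l : nat) (T : finType) :
  exists N, forall c : seq nat -> T, exists i h, mono_path c N d.+1 l i h.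
Proof.
elim: d l T => [|d IH] l T; first exact: mono_path1.
by apply: mono_pathS => // T'; apply: IH.
Qed.

Section Dicut.
Variables (R : realType) (V T : finType).

Let toggle (a : T) (C : {set T}) : {set T} := [set t | (t \in C) (+) (t == a)]%SET.

Let toggleK a : involutive (toggle a).
Proof. by move=> C; apply/setP => t; rewrite !inE -addbA addbb addbF. Qed.

Let sum_toggle a (f : {set T} -> R) : \sum_C f (toggle a C) = \sum_C f C.
Proof. by rewrite [RHS](reindex_inj (inv_inj (toggleK a))). Qed.

Lemma dicut_average (w : V -> R) (a b : V -> T) : (forall x, 0 <= w x) ->
  exists C : {set T},
    (\sum_x w x) / 4 <= \sum_(x | (a x == b x) || (a x \in C) && (b x \notin C)) w x.
Proof.
move=> w0; pose P x (C : {set T}) := (a x == b x) || (a x \in C) && (b x \notin C).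
pose f x (C : {set T}) := if P x C then w x else 0.
have f0 x C : 0 <= f x C by rewrite /f; case: ifP.
apply: contrapT => /forallNP none.
have sumlt : \sum_(C : {set T}) \sum_x f x C < \sum_(C : {set T}) (\sum_x w x) / 4.
  apply: ltr_sum; first by apply/hasP; exists finset.set0; rewrite ?mem_index_enum.
  move=> C _; rewrite -big_mkcond /= ltNge; apply/negP; exact: none.
move: sumlt; apply/negP; rewrite -leNgt exchange_big /=.
under [leLHS]eq_bigr do rewrite mulr_suml.
rewrite exchange_big /=; apply: ler_sum => x _.
have four : 4 * \sum_C f x C = \sum_C (f x C + f x (toggle (a x) C)
   + f x (toggle (b x) C) + f x (toggle (a x) (toggle (b x) C))).
  rewrite !big_split /= !sum_toggle.
  rewrite (sum_toggle (b x) (fun C => f x (toggle (a x) C))) sum_toggle; lra.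
rewrite -(ler_pM2l (_ : 0 < 4)) // four mulr_sumr; apply: ler_sum => C _.
rewrite mulrC divfK //.
have [ab|ab] := eqVneq (a x) (b x).
  by rewrite [f x C]/f /P ab eqxx /= -!addrA lerDl !addr_ge0.
have ba : (b x == a x) = false by rewrite eq_sym; apply/negbTE.
have ab' : (a x == b x) = false by apply/negbTE.
rewrite /f /P !inE !eqxx ab' ba /=.
by case: (a x \in C); case: (b x \in C); rewrite /= ?addr0 ?add0r.
Qed.

End Dicut.

Section ShiftHypergraph.
Variables (d N : nat).

Let V := {ffun 'I_d.+1 -> 'I_N.+1}.
Let path := {ffun 'I_(d + d).+1 -> 'I_N.+1}.

Definition increasing_path (h : path) : bool :=
  [forall i : 'I_(d + d).+1, forall j : 'I_(d + d).+1, (i < j)%N ==> (h i < h j)%N].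

Definition path_window (h : path) (t : 'I_d.+1) : V :=
  [ffun i : 'I_d.+1 => h (inord (t + i))].

Definition path_edge (h : path) : {set V} :=
  [set path_window h t | t in 'I_d.+1]%SET.

Definition shift_hypergraph : hypergraph :=
  @Hypergraph V [set path_edge h | h in increasing_path]%SET.

Lemma increasing_path_inj (h : path) : increasing_path h -> injective h.
Proof.
move=> /forallP inc i j hij; apply: val_inj.
have [ij|ji|//] := ltngtP (val i) (val j).
  by have /forallP/(_ j)/implyP/(_ ij) := inc i; rewrite hij ltnn.
by have /forallP/(_ i)/implyP/(_ ji) := inc j; rewrite hij ltnn.
Qed.

Lemma path_windowE (h : path) (t i : 'I_d.+1) (k : 'I_(d + d).+1) :
  k = (t + i)%N :> nat -> path_window h t i = h k.
Proof. by move=> E; rewrite ffunE -E inord_val. Qed.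

Lemma path_window_inj (h : path) : increasing_path h -> injective (path_window h).
Proof.
move=> /increasing_path_inj hinj s t E; apply: val_inj.
have := congr1 (fun v : V => v ord0) E; rewrite !ffunE => /hinj.
move=> /(congr1 (@nat_of_ord _)); rewrite !inordK ?addn0 //=.
- by have := ltn_ord t; lia.
- by have := ltn_ord s; lia.
Qed.

Lemma card_shift_edge e : e \in edges shift_hypergraph -> #|e| = d.+1.
Proof.
move=> /imsetP[h hinc ->]; rewrite card_imset ?card_ord //.
exact: path_window_inj.
Qed.

(* The hypothesis says that [A] contains [x] and a tuple starting with [x i], [0 < i < q], only if
   entries are repeated. Then the elements of [A] in an edge are at distance at least [q], so that
   the intervals of length [q] following them are disjoint. *)
Lemma card_shift_sparse (A : {set V}) (q : nat) e :
  (forall x y i, x \in A -> y \in A -> (0 < i < q)%N -> (i <= d)%N ->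
     x (inord i) = y ord0 -> x (inord i) = x ord0 \/ y (inord i) = y ord0) ->
  e \in edges shift_hypergraph -> (q * #|A :&: e| <= d.+1 + q)%N.
Proof.
move=> HA /imsetP[h hinc ->].
pose S := [set t | path_window h t \in A]%SET.
have -> : #|A :&: path_edge h| = #|S|.
  rewrite -(card_imset (mem S) (path_window_inj hinc)); apply: eq_card => x.
  rewrite !inE; apply/andP/imsetP.
    by move=> [xA /imsetP[t _ E]]; exists t; rewrite // inE -E.
  by move=> [t]; rewrite inE => tA ->; split=> //; apply: imset_f.
have sep (s t : 'I_d.+1) : s \in S -> t \in S -> (s < t)%N -> (t < s + q)%N -> False.
  rewrite !inE => sA tA st tsq.
  have := ltn_ord t => td.
  have i1 : (inord (t - s) : 'I_d.+1) = (t - s)%N :> nat by rewrite inordK //; lia.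
  have k1 : (inord t : 'I_(d + d).+1) = t :> nat by rewrite inordK //; lia.
  have k2 : (inord s : 'I_(d + d).+1) = s :> nat by rewrite inordK //; lia.
  have := HA _ _ (t - s)%N sA tA; rewrite (path_windowE h (k := inord t)); last first.
    by rewrite k1 i1 subnKC // ltnW.
  have k3 : (inord (t + (t - s)) : 'I_(d + d).+1) = (t + (t - s))%N :> nat.
    by rewrite inordK //; lia.
  rewrite (path_windowE h (k := inord t)) ?k1 ?addn0 //.
  rewrite (path_windowE h (t := t) (i := inord (t - s)) (k := inord (t + (t - s)))); last first.
    by rewrite k3 i1.
  rewrite (path_windowE h (k := inord s)) ?k2 ?addn0 //.
  have r1 : (0 < t - s < q)%N by apply/andP; split; lia.
  have r2 : (t - s <= d)%N by lia.
  move=> /(_ r1 r2 erefl) [] /(increasing_path_inj hinc) /(congr1 (@nat_of_ord _)) /=.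
    by rewrite -/(nat_of_ord _) k1 k2 => tE; move: st; rewrite tE ltnn.
  by rewrite -/(nat_of_ord _) k1 k3; lia.
pose f (p : 'I_d.+1 * 'I_q) : 'I_(d + q).+1 := inord (p.1 + p.2).
have /card_in_imset E : {in finset.setX S [set: 'I_q]%SET &, injective f}.
  move=> [s i] [t j]; rewrite !inE !andbT /= => sS tS.
  move=> /(congr1 (@nat_of_ord _)) /=; rewrite !inordK; last 2 first.
  - by have := ltn_ord t; have := ltn_ord j; rewrite /=; lia.
  - by have := ltn_ord s; have := ltn_ord i; rewrite /=; lia.
  rewrite /= => E; have := ltn_ord i; have := ltn_ord j => jq iq.
  have sS' : s \in S by rewrite inE.
  have tS' : t \in S by rewrite inE.
  have [st|ts|st] := ltngtP (val s) (val t).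
  - by case: (sep s t sS' tS' st); rewrite /= in st; lia.
  - by case: (sep t s tS' sS' ts); rewrite /= in ts; lia.
  - by congr pair; apply: val_inj => //=; rewrite /= in st; lia.
have := max_card (mem (f @: finset.setX S [set: 'I_q]%SET)%SET).
by rewrite E cardsX cardsT !card_ord mulnC.
Qed.

Lemma shift_fractional_cover (R : realType) (q : nat) (w : V -> R) :
  (forall x, 0 <= w x) -> exists A : {set V},
    (forall x y i, x \in A -> y \in A -> (0 < i < q)%N -> (i <= d)%N ->
       x (inord i) = y ord0 -> x (inord i) = x ord0 \/ y (inord i) = y ord0) /\
    4 ^- q * (\sum_x w x) <= \sum_(x in A) w x.
Proof.
move=> w0; elim: q => [|q [A [HA wA]]].
  exists [set: V]%SET; split; first by move=> x y i _ _ /andP[].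
  by rewrite expr0 invr1 mul1r; under [leRHS]eq_bigl do rewrite inE.
pose w' x := if x \in A then w x else 0.
have w'0 x : 0 <= w' x by rewrite /w'; case: ifP.
have [C HC] := @dicut_average R V _ w' (fun x => x ord0) (fun x => x (inord q)) w'0.
exists (A :&: [set x : V |
  (x ord0 == x (inord q)) || (x ord0 \in C) && (x (inord q) \notin C)])%SET.
split.
  move=> x y i; rewrite !inE => /andP[xA xC] /andP[yA yC] /andP[i0].
  rewrite ltnS leq_eqVlt => /orP[/eqP -> qd E|iq id]; last by apply: HA => //; rewrite i0.
  move: xC => /orP[/eqP ->|/andP[x0 xq]]; first by left.
  by move: yC; rewrite -E (negbTE xq) /= orbF => /eqP ->; right.
apply: le_trans (_ : _ <= 4^-1 * (\sum_(x in A) w x)) _.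
  by rewrite exprS invfM -mulrA ler_pM2l // invr_gt0.
rewrite mulrC big_mkcond /=; apply: (le_trans HC).
by rewrite /w' -big_mkcondr le_eqVlt; apply/orP; left; apply/eqP/eq_bigl => x; rewrite !inE andbC.
Qed.


Lemma shift_mono_edge (T : finType) (c : V -> T) :
  (forall c : seq nat -> T, exists i h, mono_path c N d.+1 d i h) ->
  exists2 e, e \in edges shift_hypergraph & exists i, {in e, forall x, c x = i}.
Proof.
move=> /(_ (fun s => c [ffun i : 'I_d.+1 => inord (nth 0%N s i)])) [i [s [ss so sN sc]]].
pose h : path := [ffun k : 'I_(d + d).+1 => inord (nth 0%N s k)].
have hE (k : 'I_(d + d).+1) : h k = nth 0%N s k :> nat.
  by rewrite ffunE inordK // ltnS ltnW // sN // mem_nth // ss.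
have hinc : increasing_path h.
  apply/forallP => a; apply/forallP => b; apply/implyP => ab; rewrite !hE.
  by apply: (sorted_ltn_nth ltn_trans) => //; rewrite inE ss.
exists (path_edge h); first by apply/imsetP; exists h.
exists i => _ /imsetP[t _ ->]; rewrite -(sc t); last by rewrite -ltnS.
congr c; apply/ffunP => j; apply: val_inj; rewrite !ffunE; congr (val (inord _)).
rewrite /window nth_take // nth_drop inordK //.
have := ltn_ord t; have := ltn_ord j; lia.
Qed.

End ShiftHypergraph.

(* Consider covers by sets meeting every edge in a proportion at most [1 / q]: [fractional_cover]
   bounds the fractional covering number in terms of [q] alone, while by [mono_edge] integral covers
   need, for [q > 1], more than [k.+1] sets. *)
Record pathological (R : realType) (d k : nat) (H : hypergraph) : Prop := Pathological {
  edge_card : forall e, e \in edges H -> #|e| = d;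
  edge_exists : exists e, e \in edges H;
  fractional_cover : forall (q : nat) (w : vertices H -> R), (q.*2 <= d)%N ->
    (forall x, 0 <= w x) -> exists A : {set vertices H},
      (forall e, e \in edges H -> (q * #|A :&: e| <= d)%N) /\
      4 ^- q.*2 * (\sum_x w x) <= \sum_(x in A) w x;
  mono_edge : forall c : vertices H -> 'I_k.+1, exists2 e, e \in edges H &
    exists i, {in e, forall x, c x = i} }.

Lemma pathological_exists (R : realType) (d k : nat) :
  exists H, pathological R d.+1 k H.
Proof.
have [N HN] := mono_path_exists d d 'I_k.+1.
exists (shift_hypergraph d N); split.
- exact: card_shift_edge.
- by have [e eE _] := shift_mono_edge (fun=> ord0) HN; exists e.
- move=> q w qd w0; have [A [HA wA]] := shift_fractional_cover q.*2 w0.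
  exists A; split=> // e eE; have := card_shift_sparse HA eE; rewrite -doubleMl.
  by move: (q * _)%N => m; lia.
- by move=> c; apply: shift_mono_edge.
Qed.

(** * Nikodym's theorem for power sets *)

Section GlidingHump.
Variables (R : realType) (nu : nat -> set nat -> R).
Hypothesis nuU : forall n X Y, X `&` Y = set0 -> nu n (X `|` Y) = nu n X + nu n Y.
Hypothesis nu_fin : forall n, exists K, forall X Y, X `&` Y = set0 ->
  `|nu n X| + `|nu n Y| <= K.

Let increasing (e : nat -> nat) := forall i j, (i < j)%N -> (e i < e j)%N.

Let nu0 n : nu n set0 = 0.
Proof.
have := nuU n (set0I set0); rewrite setU0 => h.
by apply: (addrI (nu n set0)); rewrite -h addr0.
Qed.

(* Otherwise each of infinitely many disjoint infinite pieces carries mass more than [1]. *)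
Lemma subsequence_small n (e : nat -> nat) : increasing e ->
  exists2 k, increasing k & forall X, X `<=` range (e \o k) -> `|nu n X| <= 1.
Proof.
move=> einc; apply: contrapT => none.
have {}none k : increasing k -> exists2 X, X `<=` range (e \o k) & 1 < `|nu n X|.
  move=> kinc; apply: contrapT => none'; apply: none; exists k => // X Xk.
  by rewrite leNgt; apply/negP => X1; apply: none'; exists X.
have grow p k : increasing k -> exists X Y, [/\ X `<=` range (e \o k), Y `<=` range (e \o k),
    X `&` Y = set0 & p%:R <= nu n X - nu n Y].
  elim: p k => [|p IH] k kinc.
    by exists set0, set0; rewrite set0I nu0 subrr; split=> //; exact: sub0set.
  have inc0 : increasing (fun i => k i.*2) by move=> i j ij; apply: kinc; lia.
  have inc1 : increasing (fun i => k i.*2.+1) by move=> i j ij; apply: kinc; lia.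
  have [Z Zk Z1] := none _ inc0.
  have [X [Y [Xk Yk XY XYp]]] := IH _ inc1.
  have sub0 W : W `<=` range (e \o (fun i => k i.*2)) -> W `<=` range (e \o k).
    by move=> Wk x /Wk[i _ <-]; exists i.*2.
  have sub1 W : W `<=` range (e \o (fun i => k i.*2.+1)) -> W `<=` range (e \o k).
    by move=> Wk x /Wk[i _ <-]; exists i.*2.+1.
  have inj i j : e (k i) = e (k j) -> i = j.
    by move=> E; case: (ltngtP i j) => // ij; have := einc _ _ (kinc _ _ ij); rewrite E ltnn.
  have disj W : W `<=` range (e \o (fun i => k i.*2.+1)) -> W `&` Z = set0.
    move=> Wk; rewrite -subset0 => x [/Wk[i _ <-] /Zk[j _]] /inj; lia.
  have [Z0|Z0] := ltP 0 (nu n Z).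
    exists (X `|` Z), Y; split.
    - by rewrite subUset; split; [exact: sub1|exact: sub0].
    - exact: sub1.
    - by rewrite setIUl XY set0U setIC disj.
    - by rewrite nuU ?disj // -natr1; move: Z1; rewrite gtr0_norm //; lra.
  exists X, (Y `|` Z); split.
  - exact: sub1.
  - by rewrite subUset; split; [exact: sub1|exact: sub0].
  - by rewrite setIUr XY set0U disj.
  - by rewrite nuU ?disj // -natr1; move: Z1; rewrite ler0_norm //; lra.
have [K HK] := nu_fin n.
have idinc : increasing id by [].
have [X [Y [_ _ XY]]] := grow (Num.truncn K).+1 id idinc.
have := HK X Y XY; have := ler_norm (nu n X); have := ler_norm (- nu n Y); rewrite normrN.
have := truncnS_gt K; lra.
Qed.

Variables (m : nat -> nat) (sigma : nat -> R).
Hypothesis sigma0 : 0 <= sigma 0%N.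
Hypothesis sigmaS : forall n s, `|nu n [set s]| + 1 <= sigma s.+1 - sigma s.
Hypothesis nu_large : forall s, sigma s < `|nu (m s) [set s]|.

Let nu_initial n s X : X `<=` `I_s -> `|nu n X| + s%:R <= sigma s.
Proof.
elim: s X => [|s IH] X Xs.
  have -> : X = set0 by rewrite -subset0 => x /Xs.
  by rewrite nu0 normr0 addr0.
have -> : X = (X `&` `I_s) `|` (X `&` [set s]).
  apply/seteqP; split=> [x Xx|x [[]|[]]//].
  by have := Xs _ Xx; rewrite /= ltnS leq_eqVlt => /orP[/eqP xs|xs]; [right|left].
have disj : (X `&` `I_s) `&` (X `&` [set s]) = set0.
  by rewrite -subset0 => x [[_ /= xs] [_ /= xE]]; rewrite xE ltnn in xs.
have := IH (X `&` `I_s) (@subIsetr _ _ _); have := sigmaS n s.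
have : `|nu n (X `&` [set s])| <= `|nu n [set s]|.
  have [Xs'|Xs'] := pselect (X s).
    by have -> : X `&` [set s] = [set s] by apply/seteqP; split=> x /= => [[]//|->].
  have -> : X `&` [set s] = set0 by rewrite -subset0 => x /= [? xs]; apply: Xs'; rewrite -xs.
  by rewrite nu0 normr0.
rewrite nuU // -natr1; have := ler_normD (nu n (X `&` `I_s)) (nu n (X `&` [set s])); lra.
Qed.

Lemma gliding_hump : exists S : set nat, forall C, exists n, C < `|nu n S|.
Proof.
have [k Hk] : exists k : (nat -> nat) -> nat -> nat, forall e, increasing e ->
    increasing (k e) /\
    forall X, X `<=` range (e \o S \o k e) -> `|nu (m (e 0%N)) X| <= 1.
  have /choice[k Hk] : forall e : nat -> nat, exists k : nat -> nat, increasing e ->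
      increasing k /\ forall X, X `<=` range (e \o S \o k) -> `|nu (m (e 0%N)) X| <= 1.
    move=> e; have [einc|] := pselect (increasing e); last by exists id.
    have einc' : increasing (e \o S) by move=> i j ij; apply: einc.
    by have [k kinc Hk] := subsequence_small (m (e 0%N)) einc'; exists k.
  by exists k.
pose next e := e \o S \o k e.
pose e i := iter i next id.
have einc i : increasing (e i).
  elim: i => [//|i IH] a b ab; rewrite /= /next /=; apply: (IH); rewrite ltnS.
  by apply: (Hk _ IH).1.
pose s i := e i 0%N.
have eS i j x : range (e (i + j)%N) x -> range (e i) x.
  elim: j x => [|j IH] x; first by rewrite addn0.
  by rewrite addnS => -[y _ <-]; apply: IH; exists (k (e (i + j)%N) y).+1.
have s_range i j : (i <= j)%N -> range (e i) (s j).
  by move=> ij; apply: (eS i (j - i)%N); rewrite subnKC //; exists 0%N.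
have sS i : (s i < s i.+1)%N by apply: einc.
have s_inc i j : (i < j)%N -> (s i < s j)%N.
  elim: j => // j IH; rewrite ltnS leq_eqVlt => /orP[/eqP ->//|/IH h].
  exact: ltn_trans h (sS j).
have s_ge i : (i <= s i)%N by elim: i => // i IH; apply: leq_ltn_trans IH (sS i).
exists (range s) => C.
pose i := (Num.truncn C).+2; exists (m (s i)).
pose L := range s `&` `I_(s i); pose H := range s `&` [set x | (s i < x)%N].
have LH : range s = (L `|` [set s i]) `|` H.
  apply/seteqP; split=> [x sx|x [[[]//|->]|[]//]]; last by exists i.
  by have [xs|xs|->] := ltngtP x (s i); [left; left|right|left; right].
have d1 : L `&` [set s i] = set0.
  by rewrite -subset0 => x [[_ /= xs] xE]; rewrite xE ltnn in xs.
have d2 : (L `|` [set s i]) `&` H = set0.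
  rewrite -subset0 => x [[[_ /= h1]|/= ->] [_ /= h2]]; last by rewrite ltnn in h2.
  by have := ltn_trans h1 h2; rewrite ltnn.
have LL := nu_initial (m (s i)) (@subIsetr _ (range s) `I_(s i)).
have HH : `|nu (m (s i)) H| <= 1.
  apply: (Hk _ (einc i)).2 => x [[j _ <-] /= sij].
  apply: (s_range i.+1 j); rewrite ltnNge; apply/negP; rewrite leq_eqVlt.
  by move=> /orP[/eqP ji|/s_inc]; [rewrite ji ltnn in sij|lia].
rewrite LH !nuU //.
have := nu_large (s i).
have : (Num.truncn C).+2%:R <= (s i)%:R :> R by rewrite ler_nat; apply: s_ge.
have := truncnS_gt C; rewrite -[_.+2%:R]natr1.
have := lerB_normD (nu (m (s i)) L + nu (m (s i)) [set s i]) (nu (m (s i)) H).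
have := lerB_normD (nu (m (s i)) [set s i]) (nu (m (s i)) L).
rewrite [nu _ [set s i] + _]addrC -/L in LL *; lra.
Qed.

End GlidingHump.

Definition uniformly_bounded_on (R : realType) (I : set (set nat))
    (mu : nat -> set nat -> R) (B : set nat) : Prop :=
  exists C, forall n A, I A -> A `<=` B -> `|mu n A| <= C.

Section IdealMeasures.
Variables (R : realType) (I : set (set nat)) (mu : nat -> set nat -> R).
Hypothesis I_ideal : is_ideal I.
Hypothesis mu_add : forall n, finitely_additive_on I (mu n).
Hypothesis mu_norm : forall n, (norm_on I (mu n) < +oo)%E.
Hypothesis mu_ptwise : forall A, I A -> exists C : R, forall n, `|mu n A| <= C.

Lemma ideal_set0 : I set0.
Proof. by case: I_ideal => Ifin _ _ _; apply: Ifin; apply: finite_set0. Qed.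

Lemma ideal_sub A B : A `<=` B -> I B -> I A.
Proof. by case: I_ideal => _ + _ _; apply. Qed.

Lemma mu_set0 n : mu n set0 = 0.
Proof.
have := mu_add n ideal_set0 ideal_set0 (set0I set0); rewrite setU0 => h.
by apply: (addrI (mu n set0)); rewrite -h addr0.
Qed.

Lemma mu_split n A B : I A -> mu n A = mu n (A `&` B) + mu n (A `\` B).
Proof.
move=> IA; rewrite -mu_add ?setUIDK //; last first.
- by rewrite setDE setIACA setICr setI0.
- by apply: ideal_sub IA; apply: subDsetl.
- by apply: ideal_sub IA; apply: subIsetl.
Qed.

Lemma mu_norm_fin n : exists K, forall A B, I A -> I B -> A `&` B = set0 ->
  `|mu n A| + `|mu n B| <= K.
Proof.
exists (fine (norm_on I (mu n))) => A B IA IB AB.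
have ub : ((`|mu n A| + `|mu n B|)%:E <= norm_on I (mu n))%E.
  by apply: ereal_sup_ubound; exists A, B.
have fin : norm_on I (mu n) \is a fin_num.
  by rewrite fin_numElt mu_norm andbT (lt_le_trans _ ub) // ltNyr.
by rewrite -lee_fin fineK.
Qed.

Lemma uniformly_boundedU B B' : uniformly_bounded_on I mu B ->
  uniformly_bounded_on I mu B' -> uniformly_bounded_on I mu (B `|` B').
Proof.
move=> [C HC] [C' HC']; exists (C + C') => n A IA AB.
rewrite (mu_split n B IA); apply: (le_trans (ler_normD _ _)); apply: lerD.
  by apply: HC; [apply: ideal_sub IA|]; [apply: subIsetl|apply: subIsetr].
apply: HC'; first by apply: ideal_sub IA; apply: subDsetl.
by move=> x [/AB[]].
Qed.

Lemma unbounded_split B (t : R) : I B -> ~ uniformly_bounded_on I mu B ->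
  exists (A : set nat) (n : nat),
    [/\ A `<=` B, t < `|mu n A| & ~ uniformly_bounded_on I mu (B `\` A)].
Proof.
move=> IB unb; have [C HC] := mu_ptwise IB.
have [n [A [IA AB Abig]]] : exists n A, [/\ I A, A `<=` B & t + C < `|mu n A|].
  apply: contrapT => none; apply: unb; exists (t + C) => n A IA AB.
  by rewrite leNgt; apply/negP => h; apply: none; exists n, A.
have BA : B `&` A = A by apply/setIidPr.
have muB := mu_split n A IB; rewrite BA in muB.
have C0 : 0 <= C by apply: le_trans (HC n).
have BDA : B `\` (B `\` A) = A by rewrite setDD BA.
have [bA|nA] := pselect (uniformly_bounded_on I mu (B `\` A)); last first.
  by exists A, n; split=> //; lra.
exists (B `\` A), n; split; first exact: subDsetl.
  have -> : mu n (B `\` A) = mu n B - mu n A by lra.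
  have := HC n; have := lerB_dist (mu n A) (mu n B); rewrite distrC; lra.
rewrite BDA => bA'; apply: unb.
have -> : B = A `|` (B `\` A) by rewrite setDUK.
exact: uniformly_boundedU.
Qed.

Lemma nikodym_powerset B : I B -> uniformly_bounded_on I mu B.
Proof.
move=> IB; apply: contrapT => unb.
pose bad D := I D /\ ~ uniformly_bounded_on I mu D.
have /choice[f Hf] : forall p : set nat * R, exists y : set nat * nat * R, bad p.1 ->
    [/\ y.1.1 `<=` p.1, p.2 < `|mu y.1.2 y.1.1|, bad (p.1 `\` y.1.1)
      & forall n, `|mu n y.1.1| <= y.2].
  move=> [D t] /=; have [[ID Dbad]|?] := pselect (bad D); last by exists (set0, 0%N, 0).
  have [A [n [AD An AB]]] := unbounded_split t ID Dbad.
  have [C HC] := mu_ptwise (ideal_sub AD ID).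
  exists (A, n, C); split=> //; split=> //.
  by apply: ideal_sub ID; apply: subDsetl.
pose next p := (p.1 `\` (f p).1.1, p.2 + 1 + (f p).2).
pose st i := iter i next (B, 0).
pose A i := (f (st i)).1.1; pose m i := (f (st i)).1.2; pose D i := (st i).1.
pose sigma i := (st i).2.
have Dbad i : bad (D i).
  elim: i => [//|i IH]; rewrite /D /= /next /=.
  by case: (Hf _ IH).
have HA i : [/\ A i `<=` D i, sigma i < `|mu (m i) (A i)|
     & forall n, `|mu n (A i)| + 1 <= sigma i.+1 - sigma i].
  have [? ? _ HC] := Hf _ (Dbad i); split=> // n.
  by rewrite /sigma [st i.+1]/= /next /=; have := HC n; rewrite -/(A i); lra.
have AD i : A i `<=` D i by case: (HA i).
have DS i : D i.+1 = D i `\` A i by [].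
have Dle i j : D (i + j)%N `<=` D i.
  elim: j => [|j IH]; first by rewrite addn0.
  by rewrite addnS DS => x [/IH].
have AB i : A i `<=` B by move=> x /AD /(Dle 0%N i).
have disj i j x : (i < j)%N -> A i x -> A j x -> False.
  move=> ij Ai /AD; have -> : j = (i.+1 + (j - i.+1))%N by lia.
  by move=> /Dle; rewrite DS => -[].
pose U (X : set nat) := \bigcup_(i in X) A i.
have IU X : I (U X) by apply: ideal_sub IB => x [i _ /AB].
have UU n X Y : X `&` Y = set0 -> mu n (U (X `|` Y)) = mu n (U X) + mu n (U Y).
  move=> XY; rewrite /U bigcup_setU; apply: mu_add; [exact: IU|exact: IU|].
  apply/seteqP; split=> // x [[i Xi Ai] [j Yj Aj]].
  have [ij|ij|ij] := ltngtP i j; [exact: disj Ai Aj|exact: disj Aj Ai|].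
  have : (X `&` Y) i by split=> //; rewrite ij.
  by rewrite XY.
have Ufin n : exists K, forall X Y, X `&` Y = set0 ->
    `|mu n (U X)| + `|mu n (U Y)| <= K.
  have [K HK] := mu_norm_fin n; exists K => X Y XY; apply: HK => //.
  apply/seteqP; split=> // x [[i Xi Ai] [j Yj Aj]].
  have [ij|ij|ij] := ltngtP i j; [exact: disj Ai Aj|exact: disj Aj Ai|].
  have : (X `&` Y) i by split=> //; rewrite ij.
  by rewrite XY.
have U1 s : U [set s] = A s by rewrite /U bigcup_set1.
have [|||S HS] := @gliding_hump R (fun n X => mu n (U X)) UU Ufin m sigma.
- by [].
- by move=> n s; rewrite U1; case: (HA s).
- by move=> s; rewrite U1; case: (HA s).
have [C HC] := mu_ptwise (IU S); have [n] := HS C.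
by rewrite ltNge HC.
Qed.

Lemma uniformly_bounded_norm :
  uniformly_bounded_on I mu setT -> exists M : R, forall n, (norm_on I (mu n) <= M%:E)%E.
Proof.
move=> [C HC]; exists (C + C) => n; apply: ge_ereal_sup => _ [A [B [IA IB _ ->]]].
by rewrite lee_fin lerD // HC.
Qed.

End IdealMeasures.

(** * Ideals given by blocks of uniform hypergraphs *)

Section BlockIdeal.
Variables (H : nat -> hypergraph) (d : nat -> nat).

Definition block_point (k : nat) (v : vertices (H k)) : nat :=
  pickle (k, nat_of_ord (enum_rank v)).

Definition block_index (x : nat) : nat :=
  if unpickle x is Some p then (p : nat * nat).1 else 0%N.

Definition trace (A : set nat) (k : nat) : {set vertices (H k)} :=
  [set v | `[< A (block_point v) >]]%SET.

Definition edge_small (q : nat) (A : set nat) (k : nat) : Prop :=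
  forall e, e \in edges (H k) -> (q * #|trace A k :&: e| <= d k)%N.

Definition block_ideal : set (set nat) :=
  [set A | forall q, exists k0, forall k, (k0 <= k)%N -> edge_small q A k].

Lemma block_pointK k (v : vertices (H k)) : block_index (block_point v) = k.
Proof. by rewrite /block_index /block_point pickleK. Qed.

Lemma block_point_inj k : injective (@block_point k).
Proof. by move=> v w /(pcan_inj pickleK)[] /ord_inj /enum_rank_inj. Qed.

Lemma in_trace A k (v : vertices (H k)) : (v \in trace A k) = `[< A (block_point v) >].
Proof. by rewrite inE. Qed.

Lemma trace_sub A B k : (forall v : vertices (H k), A (block_point v) -> B (block_point v)) ->
  trace A k \subset trace B k.
Proof. by move=> AB; apply/fintype.subsetP => v; rewrite !in_trace => /asboolP/AB/asboolP. Qed.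

Lemma traceU A B k : trace (A `|` B) k = (trace A k :|: trace B k)%SET.
Proof. by apply/setP => v; rewrite !inE asbool_or. Qed.

Lemma edge_small_sub q A B k :
  (forall v : vertices (H k), A (block_point v) -> B (block_point v)) ->
  edge_small q B k -> edge_small q A k.
Proof.
move=> /trace_sub AB sB e eE; apply: leq_trans (sB e eE).
by rewrite leq_mul2l subset_leq_card ?orbT // finset.setSI.
Qed.

Lemma edge_small_leq p q A k : (p <= q)%N -> edge_small q A k -> edge_small p A k.
Proof. by move=> pq sA e eE; apply: leq_trans (sA e eE); rewrite leq_mul2r pq orbT. Qed.

Lemma trace_disjoint A k :
  (forall v : vertices (H k), ~ A (block_point v)) -> trace A k = finset.set0.
Proof. by move=> Ak; apply/setP => v; rewrite in_trace inE; apply/asboolPn. Qed.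

Lemma edge_small_disjoint q A k :
  (forall v : vertices (H k), ~ A (block_point v)) -> edge_small q A k.
Proof.
by move=> /trace_disjoint Ak e _; rewrite Ak finset.set0I cards0 muln0.
Qed.

Lemma card_traceU (A B : set nat) k (e : {set vertices (H k)}) :
  (#|trace (A `|` B) k :&: e| <= #|trace A k :&: e| + #|trace B k :&: e|)%N.
Proof. by rewrite traceU finset.setIUl cardsU leq_subr. Qed.

Lemma edge_smallU q A B k :
  edge_small q.*2 A k -> edge_small q.*2 B k -> edge_small q (A `|` B) k.
Proof.
move=> sA sB e eE; have := sA e eE; have := sB e eE; rewrite -!doubleMl.
have : (q * #|trace (A `|` B) k :&: e| <= q * #|trace A k :&: e| + q * #|trace B k :&: e|)%N.
  by rewrite -mulnDr leq_mul2l card_traceU orbT.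
by do 3!move: (q * _)%N => ?; lia.
Qed.

Lemma finite_block_index (A : set nat) : finite_set A ->
  exists k0, forall k (v : vertices (H k)), A (block_point v) -> (k < k0)%N.
Proof.
move=> /finite_seqP[s ->]; exists (\max_(x <- s) block_index x).+1 => k v /= vs.
by rewrite ltnS -{1}(block_pointK v); exact: leq_bigmax_seq.
Qed.

Definition early_blocks (k0 : nat) : set nat :=
  [set x | exists k (v : vertices (H k)), (k < k0)%N /\ x = block_point v].

Lemma finite_early_blocks k0 : finite_set (early_blocks k0).
Proof.
elim: k0 => [|k0 IH].
  by apply: (sub_finite_set _ (finite_set0 _)) => x [k [v []]].
apply: (@sub_finite_set _ _ (early_blocks k0 `|` range (@block_point k0))).
  move=> x [k [v [kk ->]]]; move: kk; rewrite ltnS leq_eqVlt => /orP[/eqP E|kk].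
    by right; subst k0; exists v.
  by left; exists k, v.
by rewrite finite_setU; split=> //; apply: finite_image; apply: finite_finset.
Qed.

Lemma block_ideal_sub A B : A `<=` B -> block_ideal B -> block_ideal A.
Proof.
move=> AB IB q; have [k0 Hk0] := IB q; exists k0 => k /Hk0.
by apply: edge_small_sub => v; apply: AB.
Qed.

Lemma block_idealU A B : block_ideal A -> block_ideal B -> block_ideal (A `|` B).
Proof.
move=> IA IB q; have [k1 H1] := IA q.*2; have [k2 H2] := IB q.*2.
exists (maxn k1 k2) => k; rewrite geq_max => /andP[/H1 ? /H2 ?].
exact: edge_smallU.
Qed.

Lemma block_ideal_finite A : finite_set A -> block_ideal A.
Proof.
move=> /finite_block_index[k0 Hk0] q; exists k0 => k kk0.
by apply: edge_small_disjoint => v /Hk0; lia.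
Qed.

Hypothesis card_edge : forall k e, e \in edges (H k) -> #|e| = d k.
Hypothesis has_edge : forall k, exists e, e \in edges (H k).
Hypothesis d_gt1 : forall k, (1 < d k)%N.

Lemma block_idealT : ~ block_ideal setT.
Proof.
move=> /(_ 2%N)[k /(_ k (leqnn k))]; have [e eE] := has_edge k.
move=> /(_ e eE); have -> : (trace setT k :&: e)%SET = e.
  by apply/finset.setIidPr/fintype.subsetP => v _; rewrite in_trace; apply/asboolP.
by rewrite card_edge //; have := d_gt1 k; lia.
Qed.

Lemma block_ideal_ideal : is_ideal block_ideal.
Proof.
split; [exact: block_ideal_finite|exact: block_ideal_sub|exact: block_idealU|].
exact: block_idealT.
Qed.

Lemma vertex_exists k : exists v : vertices (H k), true.
Proof.
have [e eE] := has_edge k; have : (0 < #|e|)%N by rewrite card_edge // ltnW.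
by move=> /card_gt0P[v _]; exists v.
Qed.

Definition block_vertex k (x : nat) : vertices (H k) :=
  odflt (xchoose (vertex_exists k)) [pick v | block_point v == x].

Lemma block_vertexK k (v : vertices (H k)) : block_vertex k (block_point v) = v.
Proof.
rewrite /block_vertex; case: pickP => [w /eqP/block_point_inj //|/(_ v)].
by rewrite eqxx.
Qed.

Variable R : realType.

Definition block_phi : set nat -> \bar R :=
  hypergraph_phi R (fun k => range (@block_point k)) block_vertex.

Let edge_max k (A : set nat) : \bar R := \big[maxe/0%E]_(e in edges (H k))
  (#|[pred v in e | v \in @block_vertex k @` (A `&` range (@block_point k))]|%:R / #|e|%:R)%:E.

Let edge_maxE k A :
  edge_max k A = \big[maxe/0%E]_(e in edges (H k)) (#|trace A k :&: e|%:R / (d k)%:R)%:E.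
Proof.
apply: eq_bigr => e eE; rewrite card_edge //; congr ((_%:R / _)%:E).
apply: eq_card => v; rewrite !inE andbC; congr (_ && _).
apply/idP/asboolP; rewrite in_setE.
  by move=> [x [Ax [w _ E]] <-]; rewrite -E block_vertexK E.
by move=> Av; exists (block_point v); [split=> //; exists v|rewrite block_vertexK].
Qed.

Let d_pos k : 0 < (d k)%:R :> R.
Proof. by rewrite ltr0n ltnW. Qed.

Lemma edge_maxP k A (r : R) : 0 <= r ->
  (edge_max k A <= r%:E)%E <->
  (forall e, e \in edges (H k) -> #|trace A k :&: e|%:R <= r * (d k)%:R).
Proof.
move=> r0; rewrite edge_maxE; split=> [/bigmax_leP[_ h] e /h|h].
  by rewrite lee_fin ler_pdivrMr.
by apply: bigmax_le => [|e /h]; rewrite lee_fin // ler_pdivrMr.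
Qed.

Let edge_max_ge0 k A : (0 <= edge_max k A)%E.
Proof. by rewrite edge_maxE; apply: bigmax_ge_id. Qed.

Let edge_max_fin k A : edge_max k A \is a fin_num.
Proof.
have le1 : (edge_max k A <= 1%:E)%E.
  apply/edge_maxP => // e eE; rewrite mul1r ler_nat -(card_edge eE).
  by apply: subset_leq_card; apply: finset.subsetIr.
by rewrite fin_numElt (lt_le_trans _ (edge_max_ge0 k A)) ?(le_lt_trans le1) ?ltNyr ?ltry.
Qed.

Let fine_edge_max_ge0 k A : 0 <= fine (edge_max k A).
Proof. exact: fine_ge0 (edge_max_ge0 k A). Qed.

Lemma block_phi_le A (x : \bar R) :
  (block_phi A <= x)%E <-> forall k, (edge_max k A <= x)%E.
Proof.
split=> [h k|h]; last by apply: ge_ereal_sup => _ [k _ <-]; apply: h.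
by apply: le_trans h; apply: ereal_sup_ubound; exists k.
Qed.

Lemma block_phi_submeasure : is_submeasure block_phi.
Proof.
have ge0 A : (0 <= block_phi A)%E.
  by apply: le_trans (edge_max_ge0 0%N A) ((block_phi_le A _).1 (lexx _) _).
have le1 A : (block_phi A <= 1%:E)%E.
  apply/block_phi_le => k; apply/edge_maxP => // e eE.
  rewrite mul1r ler_nat -(card_edge eE).
  by apply: subset_leq_card; apply: finset.subsetIr.
have ub A := (block_phi_le A (block_phi A)).1 (lexx _).
split.
- split=> //; apply/eqP; rewrite eq_le ge0 andbT; apply/block_phi_le => k.
  apply/edge_maxP => // e eE; have -> : trace set0 k = finset.set0 by apply: trace_disjoint => v [].
  by rewrite finset.set0I cards0 mul0r.
- by move=> n; apply: le_lt_trans (le1 _) (ltry _).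
- move=> A B AB; apply/block_phi_le => k; apply: le_trans (ub B k).
  rewrite -[edge_max k B]fineK //; apply/edge_maxP; first exact: fine_edge_max_ge0.
  have := lexx (edge_max k B); rewrite -[leRHS]fineK // => /edge_maxP h e eE.
  apply: le_trans (h _ e eE); last exact: fine_edge_max_ge0.
  rewrite ler_nat subset_leq_card // finset.setSI // trace_sub // => v; exact: AB.
- move=> A B; apply/block_phi_le => k; apply: le_trans (leeD (ub A k) (ub B k)).
  rewrite -[edge_max k A]fineK // -[edge_max k B]fineK // -EFinD.
  apply/edge_maxP; first by rewrite addr_ge0.
  have := lexx (edge_max k B); rewrite -[leRHS]fineK // => /edge_maxP hB.
  have := lexx (edge_max k A); rewrite -[leRHS]fineK // => /edge_maxP hA e eE.
  rewrite mulrDl; apply: le_trans (lerD (hA _ e eE) (hB _ e eE)); try exact: fine_edge_max_ge0.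
  by rewrite -natrD ler_nat card_traceU.
Qed.

Lemma block_phi_hypergraph : is_hypergraph_submeasure block_phi.
Proof.
split; first exact: block_phi_submeasure.
exists H, (fun k => range (@block_point k)), block_vertex; split=> //.
- move=> k; split; first by apply: finite_image; apply: finite_finset.
  by have [v _] := vertex_exists k; exists (block_point v), v.
- move=> i j _ _ [x [[v _ vx] [w _ wx]]].
  by rewrite -(block_pointK v) -(block_pointK w) vx wx.
- move=> k; split=> [//|x y|v _].
    by rewrite !in_setE => -[v _ <-] [w _ <-]; rewrite !block_vertexK => ->.
  by exists (block_point v); rewrite ?block_vertexK //; exists v.
Qed.

Lemma block_phi_small q A : (0 < q)%N ->
  (block_phi A <= (q%:R^-1)%:E)%E <-> forall k, edge_small q A k.
Proof.
move=> q0; have q0' : 0 < q%:R :> R by rewrite ltr0n.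
have eqv k (e : {set vertices (H k)}) :
    (#|trace A k :&: e|%:R <= q%:R^-1 * (d k)%:R :> R) = (q * #|trace A k :&: e| <= d k)%N.
  by rewrite mulrC ler_pdivlMr // -natrM ler_nat mulnC.
split=> [/block_phi_le h k e eE|h].
  by rewrite -eqv; apply: ((edge_maxP k A _).1 (h k)) => //; rewrite invr_ge0.
by apply/block_phi_le => k; apply/edge_maxP => [|e /h]; rewrite ?invr_ge0 // eqv.
Qed.

Lemma exh_block_phi : exh block_phi = block_ideal.
Proof.
have [[ge0 _] _ mono _] := block_phi_submeasure.
have fin A : block_phi A \is a fin_num.
  have le1 : (block_phi A <= (1%:R^-1)%:E)%E.
    apply/block_phi_small => // k e eE; rewrite mul1n -(card_edge eE).
    by apply: subset_leq_card; apply: finset.subsetIr.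
  by rewrite fin_numElt (lt_le_trans _ (ge0 A)) ?(le_lt_trans le1) ?ltNyr ?ltry.
apply/seteqP; split=> A.
  move=> /fine_cvgP[_ /cvgr0Pnorm_le cv] [|q].
    by exists 0%N => k _ e _; rewrite mul0n.
  have /cv[n _ /(_ n (leqnn n))] : 0 < q.+1%:R^-1 :> R by rewrite invr_gt0 ltr0n.
  rewrite /= ger0_norm ?fine_ge0 // -lee_fin fineK // => /block_phi_small h.
  have [k0 Hk0] := finite_block_index (finite_II n.+1).
  exists k0 => k kk0; apply: edge_small_sub (h isT k) => v Av; split=> //.
  by move=> /Hk0; lia.
move=> IA; apply/fine_cvgP; split; first by near=> n; apply: fin.
apply/cvgr0Pnorm_le => eps eps0.
pose q := (Num.truncn eps^-1).+1.
have qeps : q%:R^-1 <= eps.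
  rewrite invf_ple ?posrE ?ltr0n //; exact/ltW/truncnS_gt.
have [k0 Hk0] := IA q.
have [n0 Hn0] : exists n0, early_blocks k0 `<=` `I_n0.
  have /finite_seqP[s E] := finite_early_blocks k0.
  exists (\max_(x <- s) x).+1 => x; rewrite E /= => xs; rewrite ltnS; exact: leq_bigmax_seq.
exists n0 => // n /= n0n; rewrite ger0_norm ?fine_ge0 //.
apply: le_trans qeps; rewrite -lee_fin fineK //; apply/block_phi_small => // k.
have [kk0|kk0] := ltnP k k0; last by apply: edge_small_sub (Hk0 k kk0) => v [].
apply: edge_small_disjoint => v [_]; apply => /=.
by apply: (@leq_trans n0); [apply: Hn0; exists k, v|lia].
Unshelve. all: by end_near. Qed.

Lemma block_ideal_hypergraph : is_hypergraph_ideal R block_ideal.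
Proof.
split; first exact: block_ideal_ideal.
by exists block_phi; [exact: block_phi_hypergraph|rewrite exh_block_phi].
Qed.

End BlockIdeal.

(** * The covering submeasure *)

Section CoveringSubmeasure.
Variables (R : realType) (H : nat -> hypergraph) (d : nat -> nat).
Hypothesis Hpath : forall k, pathological R (d k) k (H k).
Hypothesis d_gt1 : forall k, (1 < d k)%N.

Let covers k (A : set nat) (m : nat) : Prop := exists c : vertices (H k) -> nat,
  [/\ forall v, A (block_point v) -> (c v < m)%N
    & forall i e, e \in edges (H k) ->
        (2 * #|[set v in trace H A k | c v == i] :&: e|%SET <= d k)%N].

Let covers_exists k A : exists m, `[< covers k A m >].
Proof.
exists #|vertices (H k)|; apply/asboolP; exists (fun v => nat_of_ord (enum_rank v)).
split=> [v _|i e _]; first exact: ltn_ord.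
apply: (@leq_trans (2 * 1)); last by rewrite muln1.
rewrite leq_mul2l /=; apply/card_le1_eqP => v w; rewrite !inE.
move=> /andP[/andP[_ /eqP vi] _] /andP[/andP[_ /eqP wi] _].
by apply: enum_rank_inj; apply: ord_inj; rewrite vi wi.
Qed.

Let cov k A : nat := ex_minn (covers_exists k A).

Let covP k A : covers k A (cov k A).
Proof. by rewrite /cov; case: ex_minnP => m /asboolP. Qed.

Let cov_le k A m : covers k A m -> (cov k A <= m)%N.
Proof. by move=> /asboolP h; rewrite /cov; case: ex_minnP => n _; apply. Qed.

Let cov_sub k A B : (forall v : vertices (H k), A (block_point v) -> B (block_point v)) ->
  (cov k A <= cov k B)%N.
Proof.
move=> AB; apply: cov_le; have [c [cB cs]] := covP k B; exists c; split=> [v /AB/cB //|i e eE].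
apply: leq_trans (cs i e eE); rewrite leq_mul2l subset_leq_card // finset.setSI //.
apply/fintype.subsetP => v; rewrite !inE => /andP[/asboolP/AB h ->].
by rewrite andbT; apply/asboolP.
Qed.

Let cov_small k A : edge_small H d 2 A k -> (cov k A <= 1)%N.
Proof.
move=> sA; apply: cov_le; exists (fun=> 0%N); split=> // i e eE.
apply: leq_trans (sA e eE); rewrite leq_mul2l subset_leq_card // finset.setSI //.
by apply/fintype.subsetP => v; rewrite !inE => /andP[/asboolP].
Qed.

Let covU k A B : (cov k (A `|` B) <= cov k A + cov k B)%N.
Proof.
have [a [aA sa]] := covP k A; have [b [bB sb]] := covP k B.
apply: cov_le; exists (fun v => if v \in trace H A k then a v else cov k A + b v)%N; split.
  move=> v ABv; rewrite in_trace; case: asboolP => [/aA|nA]; first by lia.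
  by case: ABv => // /bB; lia.
move=> i e eE; have [im|mi] := ltnP i (cov k A).
  apply: leq_trans (sa i e eE); rewrite leq_mul2l subset_leq_card // finset.setSI //.
  apply/fintype.subsetP => v; rewrite !inE => /andP[/asboolP ABv].
  by case: asboolP => // nA; lia.
apply: leq_trans (sb (i - cov k A)%N e eE); rewrite leq_mul2l subset_leq_card // finset.setSI //.
apply/fintype.subsetP => v; rewrite !inE => /andP[/asboolP ABv].
case: asboolP => [/aA|nA /eqP <-]; first by lia.
by rewrite addKn eqxx andbT; apply/asboolP; case: ABv.
Qed.

Let covT k : (k.+1 < cov k setT)%N.
Proof.
rewrite ltnNge; apply/negP => le_cov; have [c [cT cs]] := covP k setT.
have [e eE [i ei]] := mono_edge (Hpath k) (fun v => inord (c v)).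
have := cs i e eE; have -> : ([set v in trace H setT k | c v == i] :&: e)%SET = e.
  apply/finset.setIidPr/fintype.subsetP => v /ei <-; rewrite inE in_trace inordK.
    by rewrite eqxx andbT; apply/asboolP.
  by apply: leq_trans le_cov; apply: cT.
by rewrite (edge_card (Hpath k)) //; have := d_gt1 k; lia.
Qed.

Let psi (A : set nat) : \bar R := ereal_sup (range (fun k => (cov k A)%:R%:E)).

Let psi_ge k A : ((cov k A)%:R%:E <= psi A)%E.
Proof. by apply: ereal_sup_ubound; exists k. Qed.

Let psi_sub A B : A `<=` B -> (psi A <= psi B)%E.
Proof.
move=> AB; apply: ge_ereal_sup => _ [k _ <-]; apply: le_trans (psi_ge k B).
by rewrite lee_fin ler_nat; apply: cov_sub => v; apply: AB.
Qed.

Let psi_submeasure : is_submeasure psi.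
Proof.
have ge0 A : (0 <= psi A)%E by apply: le_trans (psi_ge 0 A); rewrite lee_fin.
split=> //.
- split=> //; apply/eqP; rewrite eq_le ge0 andbT; apply: ge_ereal_sup => _ [k _ <-].
  rewrite lee_fin lern0 -leqn0; apply: cov_le; exists (fun=> 0%N); split=> // i e _.
  rewrite (_ : [set v in _ | _]%SET = finset.set0) ?finset.set0I ?cards0 //.
  by apply/setP => v; rewrite !inE; apply/negbTE/negP => /andP[/asboolP].
- move=> n; apply: (@le_lt_trans _ _ 1%:E); last exact: ltry.
  apply: ge_ereal_sup => _ [k _ <-]; rewrite lee_fin lern1; apply: cov_small => e _.
  apply: (@leq_trans (2 * 1)); last by rewrite muln1.
  rewrite leq_mul2l /=; apply/card_le1_eqP => v w; rewrite !inE.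
  move=> /andP[/asboolP vn _] /andP[/asboolP wn _].
  by apply: block_point_inj; rewrite vn wn.
- move=> A B; apply: ge_ereal_sup => _ [k _ <-].
  apply: le_trans (leeD (psi_ge k A) (psi_ge k B)).
  by rewrite -EFinD lee_fin -natrD ler_nat.
Qed.

Let psi_lsc : is_lsc psi.
Proof.
move=> A.
have -> : psi A = ereal_sup (range (fun n => psi (A `&` `I_n.+1))).
  apply/eqP; rewrite eq_le; apply/andP; split; last first.
    by apply: ge_ereal_sup => _ [n _ <-]; apply: psi_sub; apply: subIsetl.
  apply: ge_ereal_sup => _ [k _ <-].
  have [n kn] : exists n, forall v : vertices (H k), (block_point v < n)%N.
    exists (\max_(v : vertices (H k)) block_point v).+1 => v; rewrite ltnS.
    exact: leq_bigmax.
  apply: (@le_trans _ _ (psi (A `&` `I_n.+1))); last by apply: ereal_sup_ubound; exists n.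
  apply: le_trans (psi_ge k _); rewrite lee_fin ler_nat; apply: cov_sub => v Av.
  by split=> //=; apply: leq_trans (kn v) _.
apply: ereal_nondecreasing_cvgn => m n mn; apply: psi_sub => x [Ax /= xm].
by split=> //=; apply: leq_trans xm _.
Qed.

Lemma block_ideal_not_LGBP : ~ has_LGBP R (block_ideal H d).
Proof.
move=> /(_ psi psi_submeasure psi_lsc) L.
have /L : block_ideal H d `<=` fin psi.
  move=> A /(_ 2%N)[k0 Hk0]; apply: (@le_lt_trans _ _
    (maxn 1 (\max_(k < k0) cov k A))%:R%:E); last exact: ltry.
  apply: ge_ereal_sup => _ [k _ <-]; rewrite lee_fin ler_nat leq_max.
  have [kk0|/Hk0/cov_small -> //] := ltnP k k0.
  by rewrite (leq_bigmax (F := fun k : 'I_k0 => cov k A) (Ordinal kk0)) orbT.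
apply/negP; rewrite -leNgt leye_eq; apply/eqP/eqyP => r r0.
apply: le_trans (psi_ge (Num.truncn r) setT); rewrite lee_fin.
apply/ltW/(lt_trans (truncnS_gt r)); rewrite ltr_nat; exact: covT.
Qed.

End CoveringSubmeasure.

(** * The Nikodym property of block ideals *)

Section BlockNikodym.
Variables (R : realType) (H : nat -> hypergraph) (d : nat -> nat).
Hypothesis Hpath : forall k, pathological R (d k) k (H k).
Hypothesis d_gt1 : forall k, (1 < d k)%N.
Hypothesis d_ge : forall k, (k <= d k)%N.

Notation I := (block_ideal H d).

Let I_ideal : is_ideal I.
Proof.
by apply: block_ideal_ideal => // k; [exact: edge_card (Hpath k)|exact: edge_exists (Hpath k)].
Qed.

Lemma geometric_union (A : nat -> set nat) (j m k : nat) e : e \in edges (H k) ->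
  (forall i, edge_small H d (2 ^ i) (A i) k) ->
  (2 ^ (j + m) * #|trace H [set x | exists2 i, (i < m)%N & A (j.+1 + i)%N x] k :&: e| + d k
     <= 2 ^ m * d k)%N.
Proof.
move=> eE sA; elim: m => [|m IH].
  rewrite (trace_disjoint (A := [set x | _])); last by move=> v [].
  by rewrite finset.set0I cards0 muln0 mul1n.
set F := [set x | exists2 i, (i < m)%N & A (j.+1 + i)%N x] in IH.
have -> : [set x | exists2 i, (i < m.+1)%N & A (j.+1 + i)%N x] = F `|` A (j.+1 + m)%N.
  apply/seteqP; split=> x.
    by move=> [i]; rewrite ltnS leq_eqVlt => /orP[/eqP ->|im] Ax; [right|left; exists i].
  by move=> [[i im Ax]|Ax]; [exists i; rewrite // ltnS ltnW|exists m].
have := sA (j.+1 + m)%N e eE.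
have : (2 ^ (j + m.+1) * #|trace H (F `|` A (j.+1 + m)%N) k :&: e| <=
   2 ^ (j + m.+1) * #|trace H F k :&: e| + 2 ^ (j + m.+1) * #|trace H (A (j.+1 + m)%N) k :&: e|)%N.
  by rewrite -mulnDr leq_mul2l card_traceU orbT.
move: IH; rewrite addSn !addnS !expnS -!mulnA.
by do 4!move: (2 ^ _ * _)%N => ?; lia.
Qed.

Lemma block_ideal_bigcup (A : nat -> set nat) : (forall i, I (A i)) ->
  (forall i k, edge_small H d (2 ^ i) (A i) k) ->
  (forall i k (v : vertices (H k)), A i (block_point v) -> (i <= k)%N) ->
  I (\bigcup_i A i).
Proof.
move=> IA sA Abeyond q.
pose j := q.*2; have jq : (q.*2 <= 2 ^ j)%N by apply: ltnW; apply: ltn_expl.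
pose W1 n := [set x | exists2 i, (i < n)%N & A i x].
have IW1 n : I (W1 n).
  elim: n => [|n IH]; first by apply/block_ideal_finite/(sub_finite_set _ (finite_set0 _)) => x [].
  apply: (block_ideal_sub _ (block_idealU IH (IA n))) => x [i].
  by rewrite ltnS leq_eqVlt => /orP[/eqP ->|im] Ax; [right|left; exists i].
have [k0 Hk0] := IW1 j.+1 q.*2; exists k0 => k /Hk0 sW1.
pose W2 := [set x | exists2 i, (i < k.+1)%N & A (j.+1 + i)%N x].
apply: (@edge_small_sub _ _ _ _ (W1 j.+1 `|` W2)).
  move=> v [i _ Av]; have [ij|ji] := ltnP i j.+1; first by left; exists i.
  right; exists (i - j.+1)%N; last by rewrite subnKC.
  by have := Abeyond _ _ _ Av; lia.
apply: edge_smallU sW1 _; apply: edge_small_leq jq _ => e eE.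
have := geometric_union j k.+1 eE (sA^~ k).
rewrite expnD mulnAC => h; rewrite -(@leq_pmul2l (2 ^ k.+1)) ?expn_gt0 //.
rewrite mulnC; apply: leq_trans (leq_addr _ _) h.
Qed.

Section Measures.
Variable mu : nat -> set nat -> R.
Hypothesis mu_add : forall n, finitely_additive_on I (mu n).

Lemma mu_seq n (s : seq nat) : uniq s -> mu n [set` s] = \sum_(x <- s) mu n [set x].
Proof.
elim: s => [_|x s IH /= /andP[xs us]].
  by rewrite big_nil set_nil (mu_set0 I_ideal mu_add).
rewrite big_cons -IH // -mu_add; first congr (mu n _).
- apply/seteqP; split=> y /=; first by rewrite inE => /orP[/eqP ->|ys]; [left|right].
  by move=> [->|ys]; rewrite inE ?eqxx ?ys ?orbT.
- by apply: block_ideal_finite; apply: finite_set1.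
- by apply: block_ideal_finite; apply: finite_seq.
- by apply/seteqP; split=> // y [/= -> ys]; rewrite ys in xs.
Qed.

Definition block_union (K : nat) (B : forall k, {set vertices (H k)}) : set nat :=
  [set x | exists k (v : vertices (H k)), [/\ (k < K)%N, v \in B k & x = block_point v]].

Lemma block_union_early K B : block_union K B `<=` early_blocks H K.
Proof. by move=> x [k [v [kK _ ->]]]; exists k, v. Qed.

Lemma block_union_ideal K B : I (block_union K B).
Proof.
apply: block_ideal_finite; apply: sub_finite_set (finite_early_blocks H K).
exact: block_union_early.
Qed.

Lemma block_unionE K B k (v : vertices (H k)) :
  block_union K B (block_point v) <-> (k < K)%N /\ v \in B k.
Proof.
split=> [[l [w [lK wB E]]]|[kK vB]]; last by exists k, v.
have kl : k = l by rewrite -(block_pointK v) E block_pointK.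
by subst l; rewrite (block_point_inj E).
Qed.

Lemma mu_block_union n K B :
  mu n (block_union K B) = \sum_(k < K) \sum_(v in B k) mu n [set block_point v].
Proof.
elim: K => [|K IH].
  rewrite big_ord0 -(mu_set0 I_ideal mu_add n); congr (mu n _).
  by apply/seteqP; split=> // x [k [v []]].
pose s := [seq block_point v | v <- enum (B K)].
have -> : \sum_(k < K.+1) \sum_(v in B k) mu n [set block_point v] =
    mu n (block_union K B) + \sum_(x <- s) mu n [set x].
  by rewrite big_ord_recr /= -IH big_map big_enum.
rewrite -mu_seq; last by rewrite map_inj_uniq ?enum_uniq //; apply: block_point_inj.
rewrite -mu_add; first congr (mu n _).
- apply/seteqP; split=> x.
    move=> [k [v [kK vB ->]]]; move: kK; rewrite ltnS leq_eqVlt => /orP[/eqP kK|kK].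
      by subst k; right; rewrite /= map_f // mem_enum.
    by left; exists k, v.
  move=> [[k [v [kK vB ->]]]|/= /mapP[v vB ->]]; first by exists k, v; split=> //; rewrite ltnW.
  by exists K, v; split=> //; rewrite -mem_enum.
- exact: block_union_ideal.
- by apply: block_ideal_finite; apply: finite_seq.
- apply/seteqP; split=> // x [+ /= /mapP[v _ xE]]; rewrite xE => /block_unionE[].
  by rewrite ltnn.
Qed.

Hypothesis mu_norm : forall n, (norm_on I (mu n) < +oo)%E.
Hypothesis mu_ptwise : forall A, I A -> exists C : R, forall n, `|mu n A| <= C.

(* Outside of the first blocks, a set of the ideal is up to its finite part already small; in the
   finite part, fractional covers give a small subset keeping a fixed proportion of the measure. *)
Lemma large_small_set q k0 (C : R) : 0 <= C -> ~ uniformly_bounded_on I mu setT ->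
  exists n A, [/\ I A, forall k (v : vertices (H k)), A (block_point v) -> (k0 <= k)%N,
    forall k, edge_small H d q A k & C < `|mu n A|].
Proof.
move=> C0 unb; pose k2 := maxn k0 q.*2; pose del : R := 4 ^- q.*2.
have del0 : 0 < del by rewrite invr_gt0 exprn_gt0.
pose rest := [set x : nat | forall k (v : vertices (H k)), x <> block_point v].
have Irest : I rest.
  by move=> p; exists 0%N => k _; apply: edge_small_disjoint => v /(_ k v).
have IU : I (early_blocks H k2 `|` rest).
  by apply: block_idealU => //; apply: block_ideal_finite; apply: finite_early_blocks.
set U := _ `|` rest in IU.
have [C' HC'] := nikodym_powerset I_ideal mu_add mu_norm mu_ptwise IU.
have [n [A [IA Abig]]] : exists n A, I A /\ C' + (C + C / del) < `|mu n A|.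
  apply: contrapT => none; apply: unb; exists (C' + (C + C / del)) => n A IA _.
  by rewrite leNgt; apply/negP => h; apply: none; exists n, A.
have sub := ideal_sub I_ideal.
pose A1 := A `\` U; have IA1 : I A1 by apply: sub IA; apply: subDsetl.
have A1big : C + C / del < `|mu n A1|.
  have := mu_split I_ideal mu_add n U IA; rewrite -/A1 => E.
  have h : `|mu n (A `&` U)| <= C' by apply: HC'; [apply: sub IA; apply: subIsetl|apply: subIsetr].
  by have := ler_normD (mu n (A `&` U)) (mu n A1); rewrite -E; lra.
have A1beyond k (v : vertices (H k)) : A1 (block_point v) -> (k2 <= k)%N.
  by move=> [_ nU]; rewrite leqNgt; apply/negP => kk; apply: nU; left; exists k, v.
have k02 : (k0 <= k2)%N by apply: leq_maxl.
have [k3 Hk3] := IA1 q.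
pose Ahi := A1 `\` early_blocks H k3; pose Alo := A1 `&` early_blocks H k3.
have [hi|hi] := ltP C `|mu n Ahi|.
  exists n, Ahi; split=> //.
  - by apply: sub IA1; apply: subDsetl.
  - by move=> k v [/A1beyond h _]; apply: leq_trans h.
  - move=> k; have [kk|kk] := ltnP k k3.
      by apply: edge_small_disjoint => v [_]; apply; exists k, v.
    by apply: edge_small_sub (Hk3 k kk) => v [].
have lo : C / del < `|mu n Alo|.
  have := mu_split I_ideal mu_add n (early_blocks H k3) IA1; rewrite -/Ahi -/Alo => E.
  by have := ler_normD (mu n Alo) (mu n Ahi); rewrite -E; lra.
have [s s1 sE] : exists2 s : R, `|s| = 1 & s * mu n Alo = `|mu n Alo|.
  have [h|h] := leP 0 (mu n Alo); first by exists 1; rewrite ?normr1 // mul1r ger0_norm.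
  by exists (-1); rewrite ?normrN1 // mulN1r ltr0_norm.
pose w k (v : vertices (H k)) :=
  if v \in trace H Alo k then Num.max 0 (s * mu n [set block_point v]) else 0.
have w0 k v : 0 <= w k v by rewrite /w; case: ifP => // _; rewrite le_max lexx.
have exB k : exists B : {set vertices (H k)},
    (forall e, e \in edges (H k) -> (q * #|B :&: e| <= d k)%N) /\
    del * (\sum_v w k v) <= \sum_(v in B) w k v.
  have [kk|kk] := leqP k2 k.
    apply: (fractional_cover (Hpath k)) => //; apply: leq_trans (d_ge k); apply: leq_trans kk.
    exact: leq_maxr.
  exists finset.set0; split; first by move=> e _; rewrite finset.set0I cards0 muln0.
  rewrite big_set0 big1 ?mulr0 // => v _; rewrite /w in_trace; case: asboolP => // -[/A1beyond].
  by lia.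
pose B k := sval (cid (exB k)).
have [Bs Bw] : (forall k e, e \in edges (H k) -> (q * #|B k :&: e| <= d k)%N) /\
    forall k, del * (\sum_v w k v) <= \sum_(v in B k) w k v.
  by split=> k; rewrite /B; case: cid => ? [].
pose B' k := [set v in B k | 0 < w k v]%SET.
have w_pos k v : 0 < w k v -> Alo (block_point v) /\ w k v = s * mu n [set block_point v].
  rewrite /w in_trace; case: asboolP => [h|]; last by rewrite ltxx.
  by rewrite lt_max ltxx /= => h'; split=> //; rewrite max_r // ltW.
exists n, (block_union k3 B'); split.
- exact: block_union_ideal.
- move=> k v /block_unionE[_]; rewrite inE => /andP[_ /w_pos[[/A1beyond h _] _]].
  exact: leq_trans h.
- move=> k e eE; apply: leq_trans (Bs k e eE); rewrite leq_mul2l subset_leq_card ?orbT //.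
  apply: finset.setSI; apply/fintype.subsetP => v; rewrite in_trace => /asboolP/block_unionE[_].
  by rewrite inE => /andP[].
have loE : Alo = block_union k3 (trace H Alo).
  apply/seteqP; split=> x.
    move=> Ax; have [_ [k [v [kk E]]]] := Ax; exists k, v.
    by split; rewrite // in_trace -E; apply/asboolP.
  by move=> [k [v [_ + ->]]]; rewrite in_trace => /asboolP.
apply: (@lt_le_trans _ _ (s * mu n (block_union k3 B'))); last first.
  by apply: le_trans (ler_norm _) _; rewrite normrM s1 mul1r.
apply: (@lt_le_trans _ _ (del * `|mu n Alo|)).
  by rewrite mulrC -ltr_pdivrMr.
rewrite -sE loE !mu_block_union !mulr_sumr; apply: ler_sum => k _.
apply: (@le_trans _ _ (del * \sum_v w k v)).
  rewrite ler_pM2l // mulr_sumr big_mkcond /=; apply: ler_sum => v _.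
  by rewrite /w; case: ifP => // _; rewrite le_max lexx orbT.
apply: le_trans (Bw k) _; rewrite mulr_sumr big_mkcond [leRHS]big_mkcond /=.
apply: ler_sum => v _; rewrite inE; case: ifP => //= _.
case: ltP => [/w_pos[_ ->]//|]; exact.
Qed.

Lemma block_uniformly_bounded : uniformly_bounded_on I mu setT.
Proof.
apply: contrapT => unb.
have /choice[f Hf] : forall i : nat, exists p : nat * set nat,
    [/\ I p.2, forall k (v : vertices (H k)), p.2 (block_point v) -> (i <= k)%N,
    forall k, edge_small H d (2 ^ i) p.2 k & i%:R < `|mu p.1 p.2|].
  by move=> i; have [n [A h]] := large_small_set (2 ^ i) i (ler0n R i) unb; exists (n, A).
pose A i := (f i).2.
have IW : I (\bigcup_i A i).
  by apply: block_ideal_bigcup => [i|i k|i k v]; have [h1 h2 h3 _] := Hf i; [|apply: h3|apply: h2].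
have [C HC] := nikodym_powerset I_ideal mu_add mu_norm mu_ptwise IW.
pose i := (Num.truncn C).+1; have [IA _ _ big] := Hf i.
have : `|mu (f i).1 (A i)| <= C by apply: HC => // x Ax; exists i.
by have := truncnS_gt C; rewrite -/i; move: big; rewrite -/(A i); lra.
Qed.

End Measures.

Lemma block_ideal_Nikodym : has_Nikodym R I.
Proof.
move=> mu mu_add mu_norm mu_cvg; apply: uniformly_bounded_norm.
apply: block_uniformly_bounded => // A /mu_cvg cv.
have /cvg_seq_bounded[M [_ HM]] : cvgn (fun n => mu n A) by apply/cvg_ex; exists 0.
by exists (M + 1) => n; apply: (HM (M + 1)) => //; rewrite ltrDl.
Qed.

End BlockNikodym.

(** * Non-isomorphic ideals *)

Lemma pathological_leq (R : realType) d j k H : (j <= k)%N ->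
  pathological R d k H -> pathological R d j H.
Proof.
move=> jk [ce he fc me]; split=> // c.
have [e eE [i ei]] := me (fun v => widen_ord (jk : (j.+1 <= k.+1)%N) (c v)).
exists e => //; have [v0 v0e|e0] := pickP (mem e).
  by exists (c v0) => v ve; apply: ord_inj; have := ei v ve; rewrite -(ei _ v0e) => /(congr1 val).
by exists ord0 => v; have := e0 v; rewrite /= => ->.
Qed.

Lemma card_le_early_blocks (H : nat -> hypergraph) (V : finType) (S : {set V})
    (g : V -> nat) K : injective g -> {in S, forall v, early_blocks H K (g v)} ->
  (#|S| <= \sum_(k < K) #|vertices (H k)|)%N.
Proof.
move=> ginj gS.
pose s := flatten [seq [seq block_point v | v <- enum (vertices (H k))] | k <- index_iota 0 K].
have -> : (\sum_(k < K) #|vertices (H k)| = size s)%N.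
  rewrite size_flatten /shape -map_comp sumnE big_map big_mkord.
  by apply: eq_bigr => k _; rewrite /= size_map -cardE.
rewrite cardE -(size_map g); apply: uniq_leq_size.
  by rewrite map_inj_uniq ?enum_uniq.
move=> _ /mapP[v + ->]; rewrite mem_enum => /gS[k [u [kK ->]]].
apply/flatten_mapP; exists k; first by rewrite mem_index_iota.
by apply: map_f; rewrite mem_enum.
Qed.

Section Levels.
Variable R : realType.

(* An edge at level [n] is much larger than all lower levels together ([s] is the number of their
   vertices): this is what makes ideals using different levels non-isomorphic. *)
Definition level_step_card (n s : nat) : nat := (n.+1 * s.+1).+2.

Definition level_step (n s : nat) : hypergraph :=
  sval (cid (pathological_exists R (level_step_card n s).-1 n)).

Fixpoint level_size (n : nat) : nat :=
  if n is m.+1 then (level_size m + #|vertices (level_step m (level_size m))|)%N else 0%N.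

Definition level_hypergraph n := level_step n (level_size n).
Definition level_card n := level_step_card n (level_size n).

Lemma level_pathological n : pathological R (level_card n) n (level_hypergraph n).
Proof. by rewrite /level_hypergraph /level_step; case: cid. Qed.

Lemma level_size_leq m n : (m <= n)%N -> (level_size m <= level_size n)%N.
Proof.
move=> /subnKC <-; elim: (n - m)%N => [|p IH]; first by rewrite addn0.
by rewrite addnS; apply: leq_trans IH (leq_addr _ _).
Qed.

Definition branch (k : nat) : nat := logn 2 k.+1.

Lemma branch_infinite z k0 : exists2 k, (k0 <= k)%N & branch k = z.
Proof.
have pos : (0 < 2 ^ z * k0.*2.+1)%N by rewrite muln_gt0 expn_gt0.
exists (2 ^ z * k0.*2.+1).-1; last first.
  rewrite /branch prednK // lognM ?expn_gt0 // pfactorK // logn_coprime ?addn0 //.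
  by rewrite prime_coprime // dvdn2 /= odd_double.
have : (k0.*2.+1 <= 2 ^ z * k0.*2.+1)%N by rewrite leq_pmull // expn_gt0.
lia.
Qed.

Section OneSet.
Variable Z : set nat.

Definition level_of (k : nat) : nat := (k.*2 + `[< Z (branch k) >])%N.
Definition coded_hypergraph k := level_hypergraph (level_of k).
Definition coded_card k := level_card (level_of k).

Lemma level_of_bounds k : (k.*2 <= level_of k <= k.*2.+1)%N.
Proof. by rewrite /level_of; case: asboolP => _; rewrite ?addn0 ?addn1 !leqnn ?leqnSn. Qed.

Lemma coded_pathological k : pathological R (coded_card k) k (coded_hypergraph k).
Proof.
apply: pathological_leq (level_pathological _).
by have /andP[+ _] := level_of_bounds k; lia.
Qed.

Lemma coded_card_gt1 k : (1 < coded_card k)%N.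
Proof. by []. Qed.

Lemma coded_card_large k q : (q <= k)%N ->
  (q * level_size (level_of k) <= coded_card k)%N.
Proof.
move=> qk; rewrite /coded_card /level_card /level_step_card.
apply: (@leq_trans ((level_of k).+1 * (level_size (level_of k)).+1)); last by lia.
by apply: leq_mul => //; have /andP[+ _] := level_of_bounds k; lia.
Qed.

Lemma coded_card_ge k : (k <= coded_card k)%N.
Proof.
rewrite /coded_card /level_card /level_step_card.
apply: (@leq_trans ((level_of k).+1 * 1)).
  by rewrite muln1; have /andP[+ _] := level_of_bounds k; lia.
by apply: (@leq_trans ((level_of k).+1 * (level_size (level_of k)).+1));
  [rewrite leq_mul2l orbT|lia].
Qed.

Lemma sum_coded_size K n : (forall k, (k < K)%N -> (level_of k < n)%N) ->
  (\sum_(k < K) #|vertices (coded_hypergraph k)| <= level_size n)%N.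
Proof.
elim: K n => [|K IH] n lt_n; first by rewrite big_ord0.
rewrite big_ord_recr /=; apply: (@leq_trans (level_size (level_of K).+1)); last first.
  exact/level_size_leq/lt_n.
rewrite /= leq_add2r; apply: IH => k kK.
have /andP[_ h1] := level_of_bounds k; have /andP[h2 _] := level_of_bounds K; lia.
Qed.

Definition coded_ideal : set (set nat) := block_ideal coded_hypergraph coded_card.

End OneSet.

Lemma isomorphic_ideals_sym I J : isomorphic_ideals I J -> isomorphic_ideals J I.
Proof.
move=> [f [g fK gK] fIJ]; exists g; first by exists f.
move=> A; rewrite fIJ.
suff -> : f @` (g @` A) = A by [].
apply/seteqP; split=> x; first by move=> [_ [y Ay <-] <-]; rewrite gK.
by move=> Ax; exists (g x); [exists x|rewrite gK].
Qed.

(* Edges at the levels [k.*2.+1] with [branch k = z] are split according to whether their points go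
   to lower or to higher blocks: there are too few points in lower blocks, and too few of the edges'
   points in comparison with the edges of higher blocks. *)
Lemma coded_ideal_separated_at (Z Z' : set nat) z : Z z -> ~ Z' z ->
  ~ isomorphic_ideals (coded_ideal Z) (coded_ideal Z').
Proof.
move=> Zz Z'z [f [g fK gK] fI].
pose edge k := sval (cid (edge_exists (coded_pathological Z k))).
have edgeP k : edge k \in edges (coded_hypergraph Z k) by rewrite /edge; case: cid.
pose E := [set x | exists k (v : vertices (coded_hypergraph Z k)),
  [/\ branch k = z, v \in edge k & x = block_point v]].
pose low := E `&` [set x | early_blocks (coded_hypergraph Z') (block_index x).+1 (f x)].
pose high := E `\` low.
have E_branch k (v : vertices (coded_hypergraph Z k)) : E (block_point v) -> branch k = z.
  move=> [l [w [lz wl vw]]]; rewrite -lz; congr branch.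
  by rewrite -(block_pointK v) vw block_pointK.
have Ilow : coded_ideal Z low.
  move=> q; exists q => k qk e _.
  have [kz|kz] := pselect (branch k = z); last first.
    suff -> : trace (coded_hypergraph Z) low k = finset.set0.
      by rewrite finset.set0I cards0 muln0.
    by apply: trace_disjoint => v [/E_branch].
  apply: leq_trans (coded_card_large Z qk); rewrite leq_mul2l; apply/orP; right.
  apply: (@leq_trans #|trace (coded_hypergraph Z) low k|).
    by apply: subset_leq_card; apply: finset.subsetIl.
  apply: leq_trans (sum_coded_size (Z := Z') (K := k.+1) _).
    apply: (card_le_early_blocks (g := fun v => f (block_point v))).
      by move=> v w /(can_inj fK)/block_point_inj.
    by move=> v; rewrite in_trace => /asboolP[_] /=; rewrite block_pointK.
  move=> l; rewrite ltnS leq_eqVlt => /orP[/eqP ->|lk].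
    by rewrite /level_of kz (asboolT Zz) (asboolF Z'z) addn0 addn1.
  have /andP[_ h1] := level_of_bounds Z' l; have /andP[h2 _] := level_of_bounds Z k; lia.
have Ihigh : coded_ideal Z high.
  apply/fI => q; exists q => k qk e _.
  apply: leq_trans (coded_card_large Z' qk); rewrite leq_mul2l; apply/orP; right.
  apply: (@leq_trans #|trace (coded_hypergraph Z') (f @` high) k|).
    by apply: subset_leq_card; apply: finset.subsetIl.
  apply: leq_trans (sum_coded_size (Z := Z) (K := k) _).
    apply: (card_le_early_blocks (g := fun v => g (block_point v))).
      by move=> v w /(can_inj gK)/block_point_inj.
    move=> v; rewrite in_trace => /asboolP[x [Ex nlow] fx].
    rewrite -fx fK; have [l [w [lz wl xE]]] := Ex; exists l, w; split=> //.
    rewrite ltnNge; apply/negP => kl; apply: nlow; split=> //=.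
    by exists k, v; split=> //; rewrite xE block_pointK ltnS.
  move=> l lk.
  have /andP[_ h1] := level_of_bounds Z l; have /andP[h2 _] := level_of_bounds Z' k; lia.
have IE : coded_ideal Z E.
  apply: block_ideal_sub (block_idealU Ilow Ihigh) => x Ex.
  by have [xl|xl] := pselect (low x); [left|right].
have [k0 Hk0] := IE 2%N; have [k k0k kz] := branch_infinite z k0.
have := Hk0 k k0k (edge k) (edgeP k).
have -> : (trace (coded_hypergraph Z) E k :&: edge k)%SET = edge k.
  apply/finset.setIidPr/fintype.subsetP => v vk; rewrite in_trace.
  by apply/asboolP; exists k, v.
by rewrite (edge_card (coded_pathological Z k)) //; have := coded_card_gt1 Z k; lia.
Qed.

Lemma coded_ideal_not_isomorphic (Z Z' : set nat) : Z <> Z' ->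
  ~ isomorphic_ideals (coded_ideal Z) (coded_ideal Z').
Proof.
move=> ZZ' iso; apply: ZZ'; apply/seteqP; split=> z Zz; apply: contrapT => Z'z.
  exact: coded_ideal_separated_at Zz Z'z iso.
exact: coded_ideal_separated_at Zz Z'z (isomorphic_ideals_sym iso).
Qed.

End Levels.

Theorem theoremG (R : realType) :
  exists F : set (set (set nat)),
    [/\ (F #= [set: set nat])%card,
        forall I, F I ->
          [/\ is_hypergraph_ideal R I, has_Nikodym R I & ~ has_LGBP R I]
      & forall I J, F I -> F J -> I <> J -> ~ isomorphic_ideals I J].
Proof.
exists (range (coded_ideal R)); split.
- apply: inj_card_eq => Z Z' _ _ ZZ'; apply: contrapT => /(@coded_ideal_not_isomorphic R); apply.
  by rewrite ZZ'; exists id => [|A]; [exists id|rewrite image_id].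
- move=> _ [Z _ <-]; have path := coded_pathological R Z; split.
  + apply: block_ideal_hypergraph => // k; [exact: edge_card (path k)|exact: edge_exists (path k)].
  + exact: block_ideal_Nikodym path (coded_card_gt1 R Z) (coded_card_ge R Z).
  + exact: block_ideal_not_LGBP path (coded_card_gt1 R Z).
- move=> _ _ [Z _ <-] [Z' _ <-] IJ; apply: coded_ideal_not_isomorphic => ZZ'.
  by apply: IJ; rewrite ZZ'.
Qed.
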